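(* Let $G=(V,E)$ be an undirected Cayley graph with $n$ vertices and diameter $d$. Then the randomized query complexity of local search on $G$ is $\Omega\left(\frac{\sqrt n}{d}\right)$. (The $\Omega$ is uniform: there are absolute constants $c>0$ and $n_0$ such that the bound $c\sqrt n/d$ holds for every such $G$ with $n\ge n_0$.)
   Context: Local search: $G=(V,E)$ is a finite connected undirected graph known to the algorithm, and $f:V\to\mathbb{R}$ is an unknown function accessible through an oracle; a query names a vertex $v$ and receives $f(v)$. A vertex $v$ is a local minimum if $f(v)\le f(u)$ for all $\{u,v\}\in E$. The task is to output a local minimum. Randomized query complexity: the minimum over randomized algorithms that, for every input $f$, output a correct solution with probability at least $9/10$, of the worst-case (over inputs) expected number of queries, the expectation being over the algorithm's coin tosses. An undirected Cayley graph is formed from a (finite) group $\mathcal{G}$ and a generating set $S$ of $\mathcal{G}$: the vertices are the elements of $\mathcal{G}$, and there is an edge between vertices $u,v$ if $u=w\cdot v$ or $v=w\cdot u$ for some $w\in S$. *)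

(* Defs.v *)
From HB Require Import structures.
From mathcomp Require Import all_boot all_order all_algebra all_fingroup.
From mathcomp Require Import all_classical all_reals all_analysis.

Set Implicit Arguments.
Unset Strict Implicit.
Unset Printing Implicit Defensive.

Import Order.TTheory GRing.Theory Num.Theory.

Local Open Scope classical_set_scope.
Local Open Scope ring_scope.

Section Graph.
Variables (V : finType) (e : rel V).

Definition walk (u v : V) (k : nat) : bool :=
  [exists p : k.-tuple V, path e u p && (last u p == v)].

(** The least [k] such that there is a walk of length [k] from [u] to [v].
    A shortest walk has fewer than [#|V|] edges, so the search range is large
    enough; the value is [#|V|] when [v] cannot be reached from [u]. *)
Definition dist (u v : V) : nat := find (walk u v) (iota 0 #|V|).

Definition diameter : nat := (\max_(u : V) \max_(v : V) dist u v)%N.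

End Graph.

(** If [1 \in S] this relation has loops; they change neither the distances
    nor the local minima. *)
Definition cayley_graph (gT : finGroupType) (S : {set gT}) : rel gT :=
  fun u v => [exists w in S, (u == w * v)%g || (v == w * u)%g].

Section Algorithms.
Variables (R : realType) (V : finType).

Variant action := Query of V | Output of V.

(** A deterministic query algorithm: the next action as a function of the
    oracle answers received so far, oldest first.  The past queries need not be
    recorded, since they are determined by the answers.  Termination is not
    imposed. *)
Definition strategy := seq R -> action.

(** The answers received within the first [k] steps on input [f]; the history
    no longer changes once the algorithm has produced its output. *)
Fixpoint history (A : strategy) (f : V -> R) (k : nat) : seq R :=
  if k is k'.+1 then
    let h := history A f k' in
    if A h is Query v then rcons h (f v) else h
  else [::].

Definition outputs (A : strategy) (f : V -> R) (v : V) : Prop :=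
  exists k, A (history A f k) = Output v.

(** The total number of queries, [+oo] if the algorithm never stops. *)
Definition num_queries (A : strategy) (f : V -> R) : \bar R :=
  ereal_sup (range (fun k => ((size (history A f k))%:R)%:E)).

(** The sample space [Omega] carries the coin tosses.  For a fixed input only
    finitely many histories of each length occur, so the measurability
    condition makes the output and the number of queries random variables. *)
Record randomized_algorithm d (Omega : measurableType d) := RandomizedAlgorithm {
  strategy_of :> Omega -> strategy;
  measurable_strategy_of : forall (h : seq R) (a : action),
    measurable [set w | strategy_of w h = a]
}.

Definition expected_queries d (Omega : measurableType d)
    (P : probability Omega R) (A : randomized_algorithm Omega)
    (f : V -> R) : \bar R :=
  (\int[P]_w num_queries (A w) f)%E.

Definition worst_case_queries d (Omega : measurableType d)
    (P : probability Omega R) (A : randomized_algorithm Omega) : \bar R :=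
  ereal_sup (range (expected_queries P A)).

Definition local_minimum (e : rel V) (f : V -> R) (v : V) : Prop :=
  forall u, e v u -> f v <= f u.

Definition solves_local_search (e : rel V) d (Omega : measurableType d)
    (P : probability Omega R) (A : randomized_algorithm Omega) : Prop :=
  forall f : V -> R,
    ((9 / 10)%:E <=
       P [set w | exists2 v, outputs (A w) f v & local_minimum e f v])%E.

Definition randomized_query_complexity (e : rel V) : \bar R :=
  ereal_inf [set c | exists (d : measure_display) (Omega : measurableType d)
    (P : probability Omega R) (A : randomized_algorithm Omega),
    solves_local_search e P A /\ c = worst_case_queries P A].

End Algorithms.

(* Main.v *)
Require Import Defs.
From HB Require Import structures.
From mathcomp Require Import all_boot all_order all_algebra all_fingroup.
From mathcomp Require Import all_classical all_reals all_analysis.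
From mathcomp Require Import measurable_realfun.
From mathcomp Require Import zify ring lra.

(* Let d be the diameter, N the number of vertices and T about sqrt N / (4 d).
   Choose milestones x_0, ..., x_(T+1) independently and uniformly, and join
   each one to the next by the translate u |-> u * x_i of a fixed path of length
   d from 1 to x_(i+1) * x_i^-1.  On this staircase let f decrease to 0 along
   the walk (each vertex taking the value of its last visit), and off it let f
   exceed the staircase values by the distance to x_0.  The endpoint x_(T+1) is
   then the only local minimum.

   Give the algorithm one further milestone for free with each query, so that
   before query s it knows x_0, ..., x_s.  Unless an earlier query already hit a
   position beyond what it was given, its next query depends on these milestones
   only, whereas every position from x_(s+1) on is uniform conditionally on
   them, since right translation of the later milestones is a symmetry.  Hence
   T queries, or an output made after at most T queries, are lucky with
   probability at most (T + 1) (T d + 1) / N <= 1 / 4.  Averaging over the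
   staircases gives a single f on which more than T queries are made with
   probability at least 9 / 10 - 1 / 4, and Markov's inequality concludes. *)

Set Implicit Arguments.
Unset Strict Implicit.
Unset Printing Implicit Defensive.

Import Order.TTheory GRing.Theory Num.Theory.

Local Open Scope classical_set_scope.
Local Open Scope ring_scope.

(** * Walks and distances in a finite graph *)

Section Distance.
Local Open Scope nat_scope.
Variables (V : finType) (e : rel V).

Lemma walkP (u v : V) (k : nat) :
  reflect (exists p : seq V, [/\ path e u p, last u p = v & size p = k])
          (walk e u v k).
Proof.
apply: (iffP existsP) => [[p /andP[ep /eqP lp]]|[p [ep lp sp]]].
  by exists p; rewrite size_tuple.
by exists (Tuple (introT eqP sp)); rewrite /= ep lp eqxx.
Qed.

Lemma dist_le_walk (u v : V) (k : nat) : walk e u v k -> dist e u v <= k.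
Proof.
move=> uvk; rewrite leqNgt; apply/negP => lt_k; have := before_find 0 lt_k.
have kV : k < #|V|.
  by apply: leq_trans lt_k _; rewrite -[leqRHS](size_iota 0 #|V|) find_size.
by rewrite nth_iota // add0n uvk.
Qed.

(** A repetition-free path has fewer than [#|V|] edges, so the bounded search in [dist] succeeds. *)
Lemma walk_dist (u v : V) : connect e u v -> walk e u v (dist e u v).
Proof.
move=> /connectP[p ep ->].
case: (shortenP ep) => q eq uq _.
have lt_q : size q < #|V|.
  by have := max_card (mem (u :: q)); rewrite (card_uniqP uq).
have uvq : walk e u (last u q) (size q) by apply/walkP; exists q.
have h : has (walk e u (last u q)) (iota 0 #|V|).
  by apply/hasP; exists (size q); rewrite // mem_iota.
have := nth_find 0 h; rewrite nth_iota //.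
by rewrite -[leqRHS](size_iota 0 #|V|) -has_find.
Qed.

Lemma dist_le_diameter (u v : V) : dist e u v <= diameter e.
Proof.
apply: leq_trans (leq_bigmax u).
exact: leq_trans (leq_bigmax v).
Qed.

Lemma closer_neighbor (u v : V) :
  connect e u v -> u != v -> exists2 w, e u w & dist e w v < dist e u v.
Proof.
move=> /walk_dist /walkP[[|w p] [/= ep lp sp]] neq_uv.
  by rewrite lp eqxx in neq_uv.
move/andP: ep => [uw ep]; exists w => //.
by rewrite -sp ltnS; apply: dist_le_walk; apply/walkP; exists p.
Qed.

End Distance.

(** * Right translations and short paths in a Cayley graph *)

Section CayleyPaths.
Local Open Scope nat_scope.
Variables (gT : finGroupType) (S : {set gT}).
Hypothesis genS : <<S>>%g = [set: gT]%SET.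
Local Notation e := (cayley_graph S).

Lemma cayley_graph_mulr (u v h : gT) : e (u * h)%g (v * h)%g = e u v.
Proof.
by apply/existsP/existsP => -[w /andP[wS uv]]; exists w; rewrite wS;
  move: uv; rewrite !mulgA !(inj_eq (mulIg h)).
Qed.

Lemma cayley_connect (u v : gT) : connect e u v.
Proof.
have -> : v = ((v * u^-1) * u)%g by rewrite mulgKV.
have : (v * u^-1)%g \in <<S>>%g by rewrite genS inE.
case/gen_prodgP => n [c cS ->].
elim: n c cS => [|n IHn] c cS; first by rewrite big_ord0 mul1g.
rewrite big_ord_recl -mulgA; set q := ((\prod_(i < n) _) * u)%g.
apply: (connect_trans (IHn _ (fun i => cS (lift ord0 i)))).
by apply: connect1; apply/existsP; exists (c ord0); rewrite cS /= eqxx orbT.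
Qed.

(** Stalling steps are allowed so that all paths get the same length, which makes the segments of
    the staircase equally long. *)
Lemma cayley_paths : exists p : gT -> nat -> gT, forall g,
  [/\ p g 0 = 1%g, p g (diameter e) = g
    & forall k, p g k = p g k.+1 \/ e (p g k) (p g k.+1)].
Proof.
have H g : exists q : seq gT,
    [/\ path e 1%g q, last 1%g q = g & size q <= diameter e].
  have /walkP[q [eq lq sq]] := walk_dist (cayley_connect 1%g g).
  by exists q; rewrite sq dist_le_diameter.
(* The default value [g] of [nth] keeps the path at its endpoint once it has arrived. *)
have /choice[q Hq] := H; exists (fun g k => nth g (1%g :: q g) k) => g.
have [eq lq sq] := Hq g; split=> // [|k].
  have [lt_q|] := ltnP (size (q g)) (diameter e); first by rewrite nth_default.
  move=> le_q; have -> : diameter e = size (q g).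
    by apply/eqP; rewrite eqn_leq sq le_q.
  by rewrite -[RHS]lq; exact: (nth_last g (1%g :: q g)).
have [ge_k|lt_k] := leqP (size (q g)) k; last first.
  by right; have /(pathP g)/(_ k lt_k) := eq.
left; rewrite [RHS]nth_default // [RHS]/=.
have [->|lt_k] := eqVneq k (size (q g)); last by rewrite nth_default //=; lia.
by rewrite -[RHS]lq; exact: (nth_last g (1%g :: q g)).
Qed.

End CayleyPaths.

(** * Functions descending along a walk *)

Section Staircase.
Local Open Scope nat_scope.
Variables (V : eqType) (M : nat).
Implicit Types (y : nat -> V) (b : V -> nat) (v : V) (B m : nat).

(* Only the last visit counts, so that the walk, which may intersect itself,
   descends from each of its vertices. *)
Fixpoint stair_value y b B v : nat :=
  if B is B'.+1 then if y B' == v then M - B' else stair_value y b B' v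
  else M + b v.

Lemma eq_stair_value y y' b b' B v :
  (forall m, m < B -> y m = y' m) -> b v = b' v ->
  stair_value y b B v = stair_value y' b' B v.
Proof.
elim: B => [|B IHB] eq_y eq_b /=; first by rewrite eq_b.
by rewrite eq_y // IHB // => m lt_m; apply: eq_y; rewrite ltnS ltnW.
Qed.

Lemma stair_value_unvisited y b B B' v :
  B <= B' -> (forall m, B <= m < B' -> y m != v) ->
  stair_value y b B' v = stair_value y b B v.
Proof.
elim: B' => [|B' IHB]; first by rewrite leqn0 => /eqP ->.
rewrite leq_eqVlt ltnS => /predU1P[-> //|leB] y_v /=.
rewrite (negbTE (y_v B' _)) ?leB ?ltnSn //.
by apply: IHB => // m /andP[le_m lt_m]; apply: y_v; rewrite le_m ltnS ltnW.
Qed.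

Lemma stair_value_le y b B m :
  m < B -> stair_value y b B (y m) <= M - m.
Proof.
elim: B => //= B IHB; rewrite ltnS leq_eqVlt => /predU1P[->|lt_m].
  by rewrite eqxx.
by case: ifP => _; [apply: leq_sub2l; apply: ltnW | exact: IHB].
Qed.

Variant stair_value_spec y b B v : nat -> Prop :=
| StairOff of (forall m, m < B -> y m != v) : stair_value_spec y b B v (M + b v)
| StairLast m of m < B & y m = v & (forall j, m < j < B -> y j != v) :
    stair_value_spec y b B v (M - m).

Lemma stair_valueP y b B v : stair_value_spec y b B v (stair_value y b B v).
Proof.
elim: B => [|B IHB] /=; first by constructor.
case: ifP => [/eqP yB|/negbT yB].
  by constructor=> // j /andP[lt1 lt2]; 
    have := leq_ltn_trans lt1 lt2; rewrite ltnn.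
case: IHB => [off|m lt_m ym last_m].
  by constructor=> m; rewrite ltnS leq_eqVlt => /predU1P[->|/off].
constructor=> //; first exact: ltnW.
move=> j /andP[lt_mj]; rewrite ltnS leq_eqVlt => /predU1P[->//|lt_j].
by apply: last_m; rewrite lt_mj.
Qed.

(** Off the walk, a neighbor closer to [y 0] has a smaller value, whether or not it lies on the
    walk. On the walk, the position after the last visit to [v] is a neighbor of smaller value,
    unless that visit is the endpoint. *)
Lemma stair_local_minimum (e : rel V) y b v :
  (forall m, m < M -> y m = y m.+1 \/ e (y m) (y m.+1)) ->
  (forall u, u != y 0 -> exists2 w, e u w & b w < b u) ->
  (forall u, e v u -> stair_value y b M.+1 v <= stair_value y b M.+1 u) ->
  v = y M.
Proof.
move=> walk_y closer; case: stair_valueP => [off|m lt_m <- last_m] min_v.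
  have [|w vw lt_b] := closer v; first by rewrite eq_sym off.
  have := min_v _ vw; case: stair_valueP => [_|m _ _ _]; lia.
move: lt_m; rewrite ltnS leq_eqVlt => /predU1P[->//|lt_m].
have y_m1 : y m.+1 != y m by apply: last_m; rewrite ltnSn ltnS.
case: (walk_y m lt_m) => [eq_y|/min_v]; first by rewrite eq_y eqxx in y_m1.
have := @stair_value_le y b M.+1 m.+1 lt_m; lia.
Qed.

End Staircase.

(** * Runs against an oracle that changes from query to query *)

Section StagedHistory.
Variables (R : realType) (V : finType) (A : strategy R V).

(** An output names a vertex just as a query does, so both can be counted as guesses. *)
Definition target (a : Defs.action V) : V :=
  match a with Query v => v | Output v => v end.

Fixpoint staged_history (F : nat -> V -> R) (k : nat) : seq R :=
  if k is k'.+1 then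
    let h := staged_history F k' in
    if A h is Query v then rcons h (F k' v) else h
  else [::].

Lemma eq_staged_history (F F' : nat -> V -> R) (k : nat) :
  (forall s, (s < k)%N -> F s =1 F' s) ->
  staged_history F k = staged_history F' k.
Proof.
elim: k => //= k IHk eqF; rewrite IHk => [|s lt_s]; last by apply: eqF; lia.
by case: (A _) => // v; rewrite eqF.
Qed.

Lemma history_staged (F : nat -> V -> R) (f : V -> R) (k : nat) :
  (forall s, (s < k)%N ->
     let v := target (A (staged_history F s)) in F s v = f v) ->
  history A f k = staged_history F k.
Proof.
elim: k => //= k IHk eqF; rewrite IHk => [|s lt_s]; last by apply: eqF; lia.
by have := eqF k (ltnSn k); case: (A _) => // v /= ->.
Qed.

End StagedHistory.

(** * Random staircases and the probability of a lucky guess *)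

Section HiddenStaircase.
Local Open Scope nat_scope.

(* If [x] is uniform, then [Y x] hits [Z x] with probability [1 / #|gT|]. *)
Lemma card_equivariant (gT : finGroupType) (X : finType) (act : gT -> X -> X)
    (Y Z : X -> gT) :
  (forall h, bijective (act h)) ->
  (forall h x, Y (act h x) = (Y x * h)%g) -> (forall h x, Z (act h x) = Z x) ->
  #|gT| * #|[pred x | Y x == Z x]| = #|X|.
Proof.
move=> bij_act Yact Zact.
rewrite -sum_nat_const -[RHS]sum1_card.
(* Double counting: each [act h] preserves the number of hits, and for each [x] exactly one [h]
   gives a hit. *)
transitivity (\sum_(h : gT) \sum_(x : X) (Y x * h == Z x)%g).
  apply: eq_bigr => h _; rewrite -sum1_card big_mkcond.
  rewrite (reindex (act h)) /=; last exact: onW_bij.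
  by apply: eq_bigr => x _; rewrite inE Yact Zact; case: eqP.
rewrite exchange_big; apply: eq_bigr => x _.
rewrite (bigD1 ((Y x)^-1 * Z x)%g) //= mulKVg eqxx big1 // => h neq_h.
by apply/eqP; rewrite eqb0; apply: contra neq_h => /eqP <-; rewrite mulKg.
Qed.

Variables (R : realType) (gT : finGroupType) (e : rel gT) (d T : nat).
Variable p : gT -> nat -> gT.

Local Notation M := (T.+1 * d).
Local Notation X := {ffun 'I_T.+3 -> gT}.
Implicit Type x : X.

(* The staircase ends at milestone [T.+1]; the unused milestone [T.+2] lets
   [stair] treat its endpoint like the start of one more segment. *)
Definition milestone x (i : nat) : gT := x (inord i).

Definition stair x (m : nat) : gT :=
  let i := m %/ d in
  (p (milestone x i.+1 * (milestone x i)^-1) (m %% d) * milestone x i)%g.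

Definition base_dist x (v : gT) : nat := dist e v (milestone x 0).

Definition stair_input x (v : gT) : R :=
  (stair_value M (stair x) (base_dist x) M.+1 v)%:R%R.

(* Only the first [k.+1] segments, which depend on the milestones up to [k.+1],
   are visible. *)
Definition staged_input x (k : nat) (v : gT) : R :=
  (stair_value M (stair x) (base_dist x) (k.+1 * d) v)%:R%R.

Definition shift_after (s : nat) (h : gT) x : X :=
  [ffun i : 'I_T.+3 => if s < i then (x i * h)%g else x i].

Lemma shift_after_bij s h : bijective (shift_after s h).
Proof.
exists (shift_after s h^-1) => x; apply/ffunP => i; rewrite !ffunE;
  by have [lt_i|lt_i] := boolP (s < i);
    rewrite ?(negbTE lt_i) ?lt_i ?mulgK ?mulgKV.
Qed.

Lemma milestone_shift_lt s h x i :
  s < i < T.+3 -> milestone (shift_after s h x) i = (milestone x i * h)%g.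
Proof. by move=> /andP[lt_s lt_i]; rewrite /milestone ffunE inordK ?lt_s. Qed.

Lemma milestone_shift_ge s h x i :
  i <= s -> i < T.+3 -> milestone (shift_after s h x) i = milestone x i.
Proof.
by move=> le_i lt_i; rewrite /milestone ffunE inordK // ltnNge le_i.
Qed.

Hypothesis d_gt0 : 0 < d.

(** The factor [h] cancels in the quotient of consecutive milestones, so each later segment is
    merely translated. *)
Lemma stair_shift_ge s h x m :
  s.+1 * d <= m <= M -> stair (shift_after s h x) m = (stair x m * h)%g.
Proof.
move=> /andP[le_m leM].
have lt_s : s < m %/ d by rewrite leq_divRL.
have lt_i : m %/ d < T.+2 by rewrite ltnS -[T.+1](mulnK _ d_gt0) leq_div2r.
rewrite /stair !milestone_shift_lt ?lt_s ?(ltnW lt_s) //=; try lia.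
by rewrite invMg !mulgA mulgK.
Qed.

Lemma stair_shift_lt s h x m :
  s < T.+2 -> m < s * d -> stair (shift_after s h x) m = stair x m.
Proof.
move=> lt_s lt_m; have lt_i : m %/ d < s by rewrite ltn_divLR.
by rewrite /stair !milestone_shift_ge //; lia.
Qed.

Lemma staged_input_shift s h x k :
  k < s < T.+2 -> staged_input (shift_after s h x) k =1 staged_input x k.
Proof.
move=> /andP[lt_k lt_s] v; rewrite /staged_input; congr (_%:R)%R.
apply: eq_stair_value => [m lt_m|].
  by rewrite stair_shift_lt //; apply: leq_trans lt_m _; rewrite leq_pmul2r.
by rewrite /base_dist milestone_shift_ge.
Qed.

Lemma staged_history_shift (A : strategy R gT) s h x :
  s < T.+2 ->
  staged_history A (staged_input (shift_after s h x)) s =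
  staged_history A (staged_input x) s.
Proof.
move=> lt_s; apply: eq_staged_history => k lt_k.
by apply: staged_input_shift; rewrite lt_k.
Qed.

Definition guess (A : strategy R gT) x (s : nat) : gT :=
  target (A (staged_history A (staged_input x) s)).

(** The offsets [j] cover all hidden positions when [s] is 0; for larger [s] the guard discards
    those beyond the endpoint. *)
Definition lucky (A : strategy R gT) x (s : 'I_T.+1)
    (j : 'I_(T * d).+1) : bool :=
  (s.+1 * d + j <= M) && (stair x (s.+1 * d + j) == guess A x s).

Definition some_lucky (A : strategy R gT) : pred X :=
  [pred x | [exists s, [exists j, lucky A x s j]]].

Lemma card_lucky (A : strategy R gT) s j :
  #|gT| * #|[pred x | lucky A x s j]| <= #|X|.
Proof.
rewrite /lucky; case: (boolP (_ <= M)) => [leM|_] /=; last first.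
  by rewrite (eq_card0 (fun x => erefl)) muln0.
rewrite (@card_equivariant _ _ (shift_after s)) // => [h|h x|h x].
- exact: shift_after_bij.
- by rewrite stair_shift_ge // leM leq_addr.
- by rewrite /guess staged_history_shift // ltnS ltnW.
Qed.

Lemma card_some_lucky (A : strategy R gT) :
  #|gT| * #|some_lucky A| <= T.+1 * (T * d).+1 * #|X|.
Proof.
have le_sum : #|some_lucky A| <=
    \sum_(s < T.+1) \sum_(j < (T * d).+1) #|[pred x | lucky A x s j]|.
  rewrite -sum1_card.
  under [leqRHS]eq_bigr do under eq_bigr do rewrite -sum1_card big_mkcond.
  rewrite big_mkcond; under [leqRHS]eq_bigr do rewrite exchange_big.
  rewrite exchange_big; apply: leq_sum => x _.
  case: ifP => // /existsP[s /existsP[j xsj]].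
  by rewrite (bigD1 s) //= (bigD1 j) //= inE xsj.
apply: leq_trans (leq_mul (leqnn _) le_sum) _.
rewrite big_distrr /=; under eq_bigr do rewrite big_distrr /=.
have -> : T.+1 * (T * d).+1 * #|X| =
    \sum_(s < T.+1) \sum_(j < (T * d).+1) #|X|.
  by rewrite !sum_nat_const !card_ord mulnA.
by apply: leq_sum => s _; apply: leq_sum => j _; exact: card_lucky.
Qed.

(** A staged answer can differ from the true one only if the queried vertex is visited in a hidden
    segment, which would be a lucky guess. *)
Lemma unlucky_history (A : strategy R gT) x k :
  k <= T.+1 -> ~~ some_lucky A x ->
  history A (stair_input x) k = staged_history A (staged_input x) k.
Proof.
move=> le_k unlucky; apply: history_staged => s lt_s v.
rewrite /staged_input /stair_input; congr (_%:R)%R.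
symmetry; apply: stair_value_unvisited => [|m /andP[ge_m lt_m]].
  by apply: leqW; rewrite leq_pmul2r //; lia.
apply: contra unlucky => y_m; apply/existsP.
have lt_sT : s < T.+1 by lia.
have le_sd : s.+1 * d + T * d >= M by rewrite -mulnDl leq_pmul2r //; lia.
have lt_j : m - s.+1 * d < (T * d).+1 by lia.
exists (Ordinal lt_sT); apply/existsP; exists (Ordinal lt_j).
by rewrite /lucky /= subnKC // -ltnS lt_m.
Qed.

Hypothesis stair_walk : forall x m, m < M ->
  stair x m = stair x m.+1 \/ e (stair x m) (stair x m.+1).
Hypothesis stair0 : forall x, stair x 0 = milestone x 0.
Hypothesis connected : forall u v, connect e u v.

Lemma stair_input_local_minimum x v :
  local_minimum e (stair_input x) v -> v = stair x M.
Proof.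
move=> min_v.
apply: (@stair_local_minimum _ M e (stair x) (base_dist x)) => [m|u|u vu].
- exact: stair_walk.
- by rewrite stair0 => /(closer_neighbor (connected u _)).
- by have := min_v u vu; rewrite ler_nat.
Qed.

(** A correct output is the endpoint, which is still hidden at stage [k]; if no guess was lucky, the
    output itself would be one. *)
Lemma early_output_lucky (A : strategy R gT) x k v :
  k <= T -> A (history A (stair_input x) k) = Output v ->
  local_minimum e (stair_input x) v -> some_lucky A x.
Proof.
move=> le_k Av /stair_input_local_minimum v_end.
apply: contraT => unlucky; have lt_k : k < T.+1 by [].
move: Av; rewrite unlucky_history //; last exact: ltnW.
move=> Av; case/negP: unlucky; apply/existsP; exists (Ordinal lt_k).
have le_kM : k.+1 * d <= M by rewrite leq_pmul2r.
have lt_j : M - k.+1 * d < (T * d).+1.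
  by rewrite ltnS leq_subLR -mulnDl leq_pmul2r //; lia.
apply/existsP; exists (Ordinal lt_j).
by rewrite /lucky /guess /= subnKC // leqnn /= Av -v_end /=.
Qed.

End HiddenStaircase.

(** * Measurability of runs, and Markov's inequality *)

Section Measurability.
Variables (R : realType) (V : finType) (dsp : measure_display).
Variables (Omega : measurableType dsp) (A : @randomized_algorithm R V _ Omega).
Variable f : V -> R.

Lemma measurable_set_prop (Q : Prop) : measurable [set _ : Omega | Q].
Proof.
have [q|q] := pselect Q.
- by rewrite (_ : [set _ | _] = setT) //; apply/seteqP; split.
- by rewrite (_ : [set _ | _] = set0) //; apply/seteqP; split.
Qed.

Lemma measurable_history_eq (k : nat) (h : seq R) :
  measurable [set w | history (A w) f k = h].
Proof.
elim: k h => [|k IHk] h /=; first exact: measurable_set_prop.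
rewrite (_ : [set w | _] =
  \bigcup_(v : V)
    (([set w | history (A w) f k = h] `&` [set w | A w h = Output v])
    `|` \bigcup_(l in [set l | rcons l (f v) = h])
      ([set w | history (A w) f k = l] `&` [set w | A w l = Query v]))).
  apply: countable_bigcupT_measurable => [|v]; first exact: countableP.
  apply: measurableU.
    by apply: measurableI => //; exact: measurable_strategy_of.
  apply: fin_bigcup_measurable => [|l _].
    (* Only [h] without its last entry can be such an [l]. *)
    apply: (@sub_finite_set _ _ [set behead (belast 0 h)]) => [l <-|//].
    by rewrite /= belast_rcons.
  by apply: measurableI => //; exact: measurable_strategy_of.
apply/seteqP; split => w /=.
  case Aw: (A w _) => [v|v] hw.
    by exists v => //; right; exists (history (A w) f k).
  by exists v => //; left; split => //; rewrite -hw.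
case=> v _ [[hw Aw]|[l lh [hw Aw]]].
  by rewrite hw Aw.
by rewrite hw Aw.
Qed.

(* The histories of length [k] are images of finite sequences of vertices,
   hence countably many. *)
Lemma measurable_at_history (E : seq R -> Omega -> Prop) (k : nat) :
  (forall h, measurable [set w | E h w]) ->
  measurable [set w | E (history (A w) f k) w].
Proof.
move=> mE; rewrite (_ : [set w | _] = \bigcup_(s : seq V)
  ([set w | history (A w) f k = map f s] `&` [set w | E (map f s) w])).
  apply: countable_bigcupT_measurable => [|s]; first exact: countableP.
  by apply: measurableI => //; exact: measurable_history_eq.
apply/seteqP; split => w /= => [Ew|[s _ [-> //]]].
have [s hs] : exists s, history (A w) f k = map f s.
  elim: k {Ew} => [|k [s /= ->]]; first by exists [::].
  by case: (A w _) => v; [exists (rcons s v); rewrite map_rcons | exists s].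
by exists s => //; split => //; rewrite -hs.
Qed.

Lemma measurable_output (k : nat) (v : V) :
  measurable [set w | A w (history (A w) f k) = Output v].
Proof.
apply: (measurable_at_history (E := fun h w => A w h = Output v)) => h.
exact: measurable_strategy_of.
Qed.

Lemma measurable_outputs (e : rel V) :
  measurable [set w | exists2 v, outputs (A w) f v & local_minimum e f v].
Proof.
rewrite (_ : [set w | _] = \bigcup_(v : V) \bigcup_k
  ([set w | A w (history (A w) f k) = Output v]
   `&` [set _ | local_minimum e f v])).
  apply: countable_bigcupT_measurable => [|v]; first exact: countableP.
  apply: bigcupT_measurable => k; apply: measurableI.
    exact: measurable_output.
  exact: measurable_set_prop.
apply/seteqP; split => w /= => [[v [k Av] min_v]|[v _ [k _ [Av min_v]]]].
  by exists v => //; exists k.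
by exists v => //; exists k.
Qed.

Lemma measurable_num_queries :
  measurable_fun setT (fun w => num_queries (A w) f).
Proof.
pose q k w : \bar R := ((size (history (A w) f k))%:R)%:E.
(* As a countable supremum, the number of queries inherits measurability from the lengths of the
   histories. *)
rewrite (_ : (fun w => _) = fun w => esups (q^~ w) 0%N); last first.
  apply/funext => w; rewrite /num_queries /esups /sdrop; congr ereal_sup.
  by apply/seteqP; split => x [k _ <-]; exists k.
apply: measurable_fun_esups => k _ Y mY; rewrite setTI.
apply: (measurable_at_history (E := fun h w => Y ((size h)%:R)%:E)) => h.
exact: measurable_set_prop.
Qed.

Lemma markov_queries (P : probability Omega R) (k : nat) :
  (k%:R%:E * P [set w | (k <= size (history (A w) f k))%N]
     <= expected_queries P A f)%E.
Proof.
set B := [set w | _].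
have mB : measurable B.
  apply: (measurable_at_history (E := fun h w => (k <= size h)%N)) => h.
  exact: measurable_set_prop.
have num_ge0 w : (0 <= num_queries (A w) f)%E.
  by apply: ereal_sup_ubound; exists 0%N.
apply: (@le_trans _ _ (\int[P]_(w in B) num_queries (A w) f)%E); last first.
  by apply: ge0_subset_integral => //; exact: measurable_num_queries.
rewrite -integral_cst //; apply: ge0_le_integral => //.
- by move=> w _; rewrite lee_fin.
- by apply: measurable_funTS; exact: measurable_num_queries.
- move=> w Bw; apply: (@le_trans _ _ ((size (history (A w) f k))%:R)%:E).
    by rewrite lee_fin ler_nat.
  by apply: ereal_sup_ubound; exists k.
Qed.

End Measurability.

(** * Stopping behavior of a single run, and averaging over inputs *)

Section History.
Variables (R : realType) (V : finType) (A : strategy R V) (f : V -> R).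

Lemma history_output (s k : nat) (v : V) :
  (s <= k)%N -> A (history A f s) = Output v -> history A f k = history A f s.
Proof.
move=> le_s Av; rewrite -(subnK le_s); elim: (k - s)%N => //= n ->.
by rewrite Av.
Qed.

Lemma history_full (k : nat) :
  (k <= size (history A f k))%N \/
  exists s v, (s < k)%N /\ A (history A f s) = Output v.
Proof.
elim: k => [|k [IHk|[s [v [lt_s Av]]]]]; first by left.
- rewrite /=; case Ak: (A _) => [v|v]; first by left; rewrite size_rcons.
  by right; exists k, v.
- by right; exists s, v; split => //; exact: ltnW.
Qed.

End History.

(** By linearity, the sum is the expected number of events that occur. This turns a bound for each
    coin outcome into one on average over inputs. *)
Lemma sum_probability_le (R : realType) (dsp : measure_display)
    (Omega : measurableType dsp) (P : probability Omega R) (X : finType)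
    (W : X -> set Omega) (c : R) :
  (forall x, measurable (W x)) ->
  (forall w, \sum_(x : X) \1_(W x) w <= c) ->
  (\sum_(x : X) P (W x) <= c%:E)%E.
Proof.
move=> mW le_c.
have m1 x : measurable_fun setT (fun w => (\1_(W x) w : R)%:E).
  by apply/measurable_EFinP; exact: measurable_indic.
under eq_bigr => x _ do
  rewrite -[W x]setIT -(integral_indic P measurableT (mW x)).
rewrite -ge0_integral_sum //.
have -> : c%:E = (\int[P]_(w in setT) cst c%:E w)%E.
  rewrite integral_cst // -[LHS]mule1; congr (_ * _)%E.
  exact/esym/(probability_setT P).
apply: ge0_le_integral => //.
- by move=> w _; apply: sume_ge0 => x _; rewrite lee_fin.
- exact: emeasurable_sum.
- by move=> w _; rewrite sumEFin lee_fin.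
Qed.

(** * The lower bound for a given number of segments *)

Section LowerBound.
Variables (R : realType) (gT : finGroupType) (e : rel gT) (d T : nat).
Variable p : gT -> nat -> gT.
Hypothesis e_mulr : forall u v h, e (u * h)%g (v * h)%g = e u v.
Hypothesis e_connected : forall u v, connect e u v.
Hypothesis d_gt0 : (0 < d)%N.
Hypothesis p_path : forall g,
  [/\ p g 0 = 1%g, p g d = g
    & forall k, p g k = p g k.+1 \/ e (p g k) (p g k.+1)].

Local Notation X := {ffun 'I_T.+3 -> gT}.

Lemma stair_start (x : X) : stair d p x 0 = milestone x 0.
Proof.
rewrite /stair div0n mod0n.
by have [-> _ _] := p_path (milestone x 1 * (milestone x 0)^-1)%g; rewrite mul1g.
Qed.

Lemma stair_succ (x : X) (m : nat) :
  stair d p x m = stair d p x m.+1 \/ e (stair d p x m) (stair d p x m.+1).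
Proof.
have -> : stair d p x m.+1 =
    (p (milestone x (m %/ d).+1 * (milestone x (m %/ d))^-1) (m %% d).+1
       * milestone x (m %/ d))%g.
  rewrite /stair divnS // modnS.
  case: (boolP (d %| m.+1)%N) => [d_m|_] /=; last by rewrite add0n.
  rewrite add1n.
  have p0 g : p g 0 = 1%g by have [] := p_path g.
  have pd g : p g d = g by have [] := p_path g.
  have -> : (m %% d).+1 = d.
    apply/eqP; rewrite eqn_leq ltn_pmod //= dvdn_leq //.
    by rewrite /dvdn -[(m %% d).+1]addn1 modnDml addn1.
  by rewrite p0 pd mul1g mulgKV.
rewrite /stair.
have [_ _ /(_ (m %% d)%N) [->|]] :=
  p_path (milestone x (m %/ d).+1 * (milestone x (m %/ d))^-1)%g.
  by left.
by rewrite -(e_mulr _ _ (milestone x (m %/ d))); right.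
Qed.

Lemma expected_queries_lower_bound (dsp : measure_display)
    (Omega : measurableType dsp) (P : probability Omega R)
    (A : @randomized_algorithm R gT _ Omega) :
  solves_local_search e P A ->
  let eps : R := (T.+1 * (T * d).+1)%N%:R / #|gT|%:R in
  exists f, ((T.+1%:R * (9 / 10 - eps))%:E <= expected_queries P A f)%E.
Proof.
move=> solvesA eps; pose f (x : X) := stair_input R e d p x.
(* The event that a correct output appears after at most [T] queries. *)
pose W (x : X) := \bigcup_(k in `I_T.+1) \bigcup_(v : gT)
  ([set w | A w (history (A w) (f x) k) = Output v]
   `&` [set _ | local_minimum e (f x) v]).
have mW x : measurable (W x).
  apply: bigcup_measurable => k _.
  apply: countable_bigcupT_measurable => [|v]; first exact: countableP.
  by apply: measurableI; [exact: measurable_output|exact: measurable_set_prop].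
have gT_gt0 : 0 < #|gT|%:R :> R.
  by rewrite ltr0n; apply/card_gt0P; exists 1%g.
have X_gt0 : 0 < #|X|%:R :> R.
  by rewrite ltr0n; apply/card_gt0P; exists [ffun=> 1%g].
have sumW w : \sum_(x : X) \1_(W x) w <= eps * #|X|%:R :> R.
  apply: (@le_trans _ _ (#|some_lucky e d p (T := T) (A w)|%:R)).
    rewrite -sum1_card natr_sum [leRHS]big_mkcond; apply: ler_sum => x _.
    rewrite indicE; case: (boolP (w \in W x)) => [|_]; last by case: ifP.
    rewrite inE => -[k lt_k [v _ [Av min_v]]].
    suff -> : x \in some_lucky e d p (T := T) (A w) by [].
    exact: (early_output_lucky d_gt0 (fun x m _ => stair_succ x m) stair_start
      e_connected lt_k Av min_v).
  rewrite /eps mulrAC ler_pdivlMr // -!natrM ler_nat mulnC.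
  exact: card_some_lucky.
(* Otherwise the probabilities would sum to more than [eps * #|X|]. *)
have [x Wx] : exists x : X, (P (W x) <= eps%:E)%E.
  apply: contrapT => /forallNP noW.
  have finW x : P (W x) \is a fin_num by exact: fin_num_measure.
  have := sum_probability_le P mW sumW; apply/negP; rewrite -ltNge.
  under eq_bigr => x _ do rewrite -(fineK (finW x)).
  rewrite sumEFin lte_fin mulr_natr -sumr_const.
  apply: ltr_sum => [|x _].
    by apply/hasP; exists [ffun=> 1%g]; rewrite ?mem_index_enum.
  by rewrite -lte_fin fineK // ltNge; apply/negP/noW.
exists (f x); apply: le_trans (markov_queries A (f x) P T.+1).
set B := [set w | _].
have mB : measurable B.
  apply: (@measurable_at_history _ _ _ _ A (f x)
    (fun h _ => (T < size h)%N)) => h.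
  exact: measurable_set_prop.
rewrite EFinM; apply: lee_wpmul2l => //.
(* A successful run either stops within [T] steps or makes at least [T.+1] queries. *)
have le_sol : (P [set w | exists2 v, outputs (A w) (f x) v
                        & local_minimum e (f x) v] <= P (W x `|` B))%E.
  apply: le_measure; rewrite ?inE.
  - exact: measurable_outputs.
  - exact: measurableU.
  move=> w [v [k Av] min_v].
  have [full|[s [u [lt_s Au]]]] := history_full (A w) (f x) T.+1.
    by right.
  left; have [le_k|lt_k] := leqP k T; first by exists k => //; exists v.
  have le_s : (s <= k)%N by lia.
  exists s => //; exists v => //; split=> //=.
  by rewrite -(history_output le_s Au).
have : ((9 / 10)%:E <= eps%:E + P B)%E.
  apply: le_trans (solvesA (f x)) _; apply: le_trans le_sol _.
  by apply: le_trans (measureU2 _ _ _) _ => //; exact: leeD.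
have finB : P B \is a fin_num by exact: fin_num_measure.
by rewrite -(fineK finB) -EFinD !lee_fin -lerBlDl.
Qed.

End LowerBound.

(** Both factors are at most [a / 4 + 1], which is at most [a / 2] since [4 <= a]. *)
Lemma success_bound (R : realType) (a t d : R) :
  4 <= a -> 1 <= d -> 0 <= t -> t * (4 * d) <= a ->
  (t + 1) * (t * d + 1) <= a ^+ 2 / 4.
Proof.
move=> a4 d1 t0 le_a.
have td0 : 0 <= t * d by nra.
have le_td : t <= t * d by nra.
have td_a : t * d <= a / 4 by lra.
have : (t + 1) * (t * d + 1) <= (a / 4 + 1) * (a / 4 + 1) by apply: ler_pM; lra.
nra.
Qed.

Theorem corollary3 (R : realType) :
  exists (c : R) (n0 : nat), 0 < c /\
    forall (gT : finGroupType) (S : {set gT}),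
      <<S>>%g = [set: gT]%SET -> (n0 <= #|gT|)%N ->
      ((c * Num.sqrt (#|gT|%:R) / (diameter (cayley_graph S))%:R)%:E
         <= randomized_query_complexity R (cayley_graph S))%E.
Proof.
(* The constant is a product of 1/4, from [T.+1 > a / (4 * d)], and 1/2, which is below 9/10 - 1/4.
   The threshold 16 gives [4 <= a] for the square root [a] of the order. *)
exists 8^-1, 16%N; split; first by rewrite invr_gt0.
move=> gT S genS n16; set e := cayley_graph S; set d := diameter e.
have [p p_path] := cayley_paths genS.
(* With diameter 0 every path would end where it starts, at 1, so the group would be trivial. *)
have d_gt0 : (0 < d)%N.
  rewrite lt0n; apply/eqP => d0.
  suff : (#|gT| <= 1)%N by lia.
  apply/card_le1P => g _ h; rewrite !inE.
  have [p0 pd _] := p_path g; have [q0 qd _] := p_path h.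
  by rewrite -pd -qd -/e -/d d0 p0 q0 eqxx.
apply/ereal_infP => _ [dsp] [Om] [P] [A] [solvesA ->].
set a := Num.sqrt _.
have a2 : a ^+ 2 = #|gT|%:R by rewrite sqr_sqrtr.
have a4 : 4 <= a.
  have -> : 4 = Num.sqrt (16%:R : R).
    by rewrite (_ : 16%:R = 4 ^+ 2 :> R) ?sqrtr_sqr ?ger0_norm //; lra.
  by rewrite ler_sqrt ?ler_nat.
have d1 : 1 <= d%:R :> R by rewrite ler1n.
pose T := Num.truncn (a / (4 * d%:R)).
have /andP[leT gtT] : T%:R <= a / (4 * d%:R) < T.+1%:R.
  by apply: truncn_itv; apply: divr_ge0; lra.
have d4 : 0 < 4 * d%:R :> R by lra.
have [f] := expected_queries_lower_bound T (cayley_graph_mulr S)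
  (cayley_connect genS) d_gt0 p_path solvesA.
set eps : R := _ / #|gT|%:R => lef.
have le_eps : eps <= 1 / 4.
  rewrite /eps ler_pdivrMr -?a2; last by nra.
  rewrite natrM -[T.+1]addn1 -[(T * d).+1]addn1 !natrD natrM.
  rewrite [leRHS](_ : _ = a ^+ 2 / 4); last by ring.
  by apply: success_bound => //; rewrite -ler_pdivlMr.
apply: (@le_trans _ _ (expected_queries P A f)); last first.
  by apply: ereal_sup_ubound; exists f.
apply: le_trans lef; rewrite lee_fin.
have -> : 8^-1 * a / d%:R = (a / (4 * d%:R)) * 2^-1.
  field.
  by apply/eqP; lra.
apply: ler_pM; [apply: divr_ge0; lra|lra|exact: ltW|lra].
Qed.
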